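(* Let $\hat n_i^k(t)$ be the estimates generated by the running consensus algorithm $\hat{\mathbf n}_i(t)=P(\hat{\mathbf n}_i(t-1)+\boldsymbol\xi_i(t))$, $\hat{\mathbf s}_i(t)=P(\hat{\mathbf s}_i(t-1)+\mathbf r_i(t))$, $\hat\mu_i^k(t)=\hat s_i^k(t)/\hat n_i^k(t)$, where $P=I_M-\frac{\kappa}{d_{\max}}L_{\mathcal G}$ is doubly stochastic. Then for every arm $i\in\{1,\dots,N\}$, every agent $k\in\{1,\dots,M\}$ and every time $t\ge 1$: 1. the estimate $\hat n_i^k(t)$ satisfies $$n_i^{\text{cent}}(t)-\epsilon_n\le \hat n_i^k(t)\le n_i^{\text{cent}}(t)+\epsilon_n;$$ 2. the estimate $\hat n_i^k(t)$ and the sequences $\{\xi_i^j(\tau)\}_{\tau\in\{1,\dots,t\}}$, $j\in\{1,\dots,M\}$, satisfy $$\sum_{\tau=1}^{t}\sum_{j=1}^M\left(\sum_{p=1}^M\lambda_p^{t-\tau+1}u_p^k u_p^j\right)^2\xi_i^j(\tau)\le\frac{\hat n_i^k(t)+\epsilon_c^k}{M}.$$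
   Context: There are $M$ agents and $N$ arms. The agents are the nodes of a connected undirected graph $\mathcal G$ with Laplacian $L_{\mathcal G}\in\mathbb R^{M\times M}$ and maximum degree $d_{\max}$. Set $P=I_M-\frac{\kappa}{d_{\max}}L_{\mathcal G}$ with $\kappa\in(0,1]$. The eigenvalues of $P$ are $\lambda_1=1>\lambda_2\ge\dots\ge\lambda_M>-1$ (standing assumption), with corresponding orthonormal eigenvectors $\mathbf u_1,\dots,\mathbf u_M$, $\mathbf u_1=\mathbf 1_M/\sqrt M$; $u_p^d$ denotes the $d$-th entry of $\mathbf u_p$. At each time $t=1,2,\dots$ agent $k$ selects one arm $i^k(t)$; $\xi_i^k(t)=1$ if $i^k(t)=i$ and $0$ otherwise. $r_i^k(t)$ is the realized reward at arm $i$ for agent $k$ at time $t$. $\boldsymbol\xi_i(t)$ is the vector with entries $\xi_i^k(t)$, $\mathbf r_i(t)$ is the vector with entries $r_i^k(t)\,\xi_i^k(t)$, and $\hat{\mathbf n}_i(t),\hat{\mathbf s}_i(t)$ are the vectors with entries $\hat n_i^k(t),\hat s_i^k(t)$, $k\in\{1,\dots,M\}$. The estimates are initialized by $\hat{\mathbf n}_i(0)=\hat{\mathbf s}_i(0)=0$. $n_i^{\text{cent}}(t)=\frac1M\sum_{\tau=1}^t\mathbf 1_M^\top\boldsymbol\xi_i(\tau)$ is the number of times arm $i$ has been selected until time $t$ per unit agent. The graph explore-exploit index is $$\epsilon_n=\sqrt M\sum_{p=2}^M\frac{|\lambda_p|}{1-|\lambda_p|}.$$ The nodal explore-exploit centrality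 index of node $k$ is $$\epsilon_c^k=M\sum_{p=1}^M\sum_{j=2}^M\frac{|\lambda_p\lambda_j|}{1-|\lambda_p\lambda_j|}a_{pj}(k),$$ where $a_{pj}(k)=\nu_{pj}^{\text{+sum}}u_p^ku_j^k$ if $\lambda_p\lambda_j\ge0$ and $u_p^ku_j^k\ge0$; $a_{pj}(k)=\nu_{pj}^{\text{-sum}}u_p^ku_j^k$ if $\lambda_p\lambda_j\ge0$ and $u_p^ku_j^k\le0$; $a_{pj}(k)=\nu_{pj}^{\max}|u_p^ku_j^k|$ if $\lambda_p\lambda_j<0$; with $\nu_{pj}^{\text{+sum}}=\sum_{d=1}^Mu_p^du_j^d\,\mathds 1(u_p^du_j^d\ge0)$, $\nu_{pj}^{\text{-sum}}=\sum_{d=1}^Mu_p^du_j^d\,\mathds 1(u_p^du_j^d\le0)$, $\nu_{pj}^{\max}=\max\{|\nu_{pj}^{\text{-sum}}|,\nu_{pj}^{\text{+sum}}\}$, where $\mathds 1(\cdot)$ is the indicator function. *)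

(* Defs.v *)
From mathcomp Require Import all_boot all_order all_algebra.
From mathcomp Require Import reals.

(* Agents are 'I_M and arms 'I_N, numbered from 0: the p-th
   eigenpair is (lam p, u p) with p : 'I_M, so the leading one has index 0 and
   "p = 2, ..., M" reads 0 < p.  The d-th entry of the vector u p is u p d 0. *)

Set Implicit Arguments.
Unset Strict Implicit.
Unset Printing Implicit Defensive.

Import Order.TTheory GRing.Theory Num.Theory.
Local Open Scope ring_scope.

Definition connected_simple_graph (M : nat) (e : rel 'I_M) : Prop :=
  [/\ symmetric e, irreflexive e & forall x y : 'I_M, connect e x y].

Definition degree (M : nat) (e : rel 'I_M) (x : 'I_M) : nat :=
  #|[set y | e x y]|.

Definition max_degree (M : nat) (e : rel 'I_M) : nat :=
  (\max_(x < M) degree e x)%N.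

Definition laplacian (R : realType) (M : nat) (e : rel 'I_M) : 'M[R]_M :=
  diag_mx (\row_x (degree e x)%:R) - \matrix_(x, y) (e x y)%:R.

(* For a single agent the maximum degree and the Laplacian are both 0, and the
   convention 0^-1 = 0 makes this the identity. *)
Definition consensus_mx (R : realType) (M : nat) (e : rel 'I_M) (kappa : R) :
    'M[R]_M :=
  1%:M - (kappa / (max_degree e)%:R) *: laplacian R e.

Definition doubly_stochastic (R : realType) (M : nat) (A : 'M[R]_M) : Prop :=
  [/\ forall x y, 0 <= A x y,
      forall x, \sum_(y < M) A x y = 1
    & forall y, \sum_(x < M) A x y = 1].

(* The M orthonormal eigenvectors form a basis, so lam lists the whole spectrum
   of A with multiplicities. *)
Record consensus_spectrum (R : realType) (M : nat) (A : 'M[R]_M)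
    (lam : 'I_M -> R) (u : 'I_M -> 'cV[R]_M) : Prop := ConsensusSpectrum {
  spectrum_eigen : forall p, A *m u p = lam p *: u p;
  spectrum_orthonormal :
    forall p q, \sum_(d < M) u p d 0 * u q d 0 = (p == q)%:R;
  spectrum_lam1 : forall p : 'I_M, p = 0%N :> nat -> lam p = 1;
  spectrum_u1 :
    forall p : 'I_M, p = 0%N :> nat -> u p = const_mx (Num.sqrt M%:R)^-1;
  spectrum_lt1 : forall p : 'I_M, (0 < p)%N -> lam p < 1;
  spectrum_noninc : forall p q : 'I_M, (p <= q)%N -> lam q <= lam p;
  spectrum_gtN1 : forall p, -1 < lam p }.

Definition xi (R : realType) (M N : nat) (arm : 'I_M -> nat -> 'I_N)
    (i : 'I_N) (t : nat) : 'cV[R]_M :=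
  \col_k (arm k t == i)%:R.

Definition reward_vec (R : realType) (M N : nat) (arm : 'I_M -> nat -> 'I_N)
    (r : 'I_N -> 'I_M -> nat -> R) (i : 'I_N) (t : nat) : 'cV[R]_M :=
  \col_k (r i k t * xi R arm i t k 0).

(* Selections and rewards at times t >= 1 only are used.  The quotient defining
   the mean estimate is constrained only where it makes sense. *)
Record running_consensus (R : realType) (M N : nat) (A : 'M[R]_M)
    (arm : 'I_M -> nat -> 'I_N) (r : 'I_N -> 'I_M -> nat -> R)
    (nhat shat muhat : 'I_N -> nat -> 'cV[R]_M) : Prop := RunningConsensus {
  consensus_n0 : forall i, nhat i 0%N = 0;
  consensus_s0 : forall i, shat i 0%N = 0;
  consensus_nS : forall i t, nhat i t.+1 = A *m (nhat i t + xi R arm i t.+1);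
  consensus_sS :
    forall i t, shat i t.+1 = A *m (shat i t + reward_vec arm r i t.+1);
  consensus_mu : forall i t k, (0 < t)%N -> nhat i t k 0 != 0 ->
    muhat i t k 0 = shat i t k 0 / nhat i t k 0 }.

Definition n_cent (R : realType) (M N : nat) (arm : 'I_M -> nat -> 'I_N)
    (i : 'I_N) (t : nat) : R :=
  M%:R^-1 * \sum_(1 <= tau < t.+1) \sum_(k < M) xi R arm i tau k 0.

Definition eps_n (R : realType) (M : nat) (lam : 'I_M -> R) : R :=
  Num.sqrt M%:R * \sum_(p < M | (0 < p)%N) `|lam p| / (1 - `|lam p|).

Definition nu_plus (R : realType) (M : nat) (u : 'I_M -> 'cV[R]_M)
    (p j : 'I_M) : R :=
  \sum_(d < M | 0 <= u p d 0 * u j d 0) u p d 0 * u j d 0.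

Definition nu_minus (R : realType) (M : nat) (u : 'I_M -> 'cV[R]_M)
    (p j : 'I_M) : R :=
  \sum_(d < M | u p d 0 * u j d 0 <= 0) u p d 0 * u j d 0.

Definition nu_max (R : realType) (M : nat) (u : 'I_M -> 'cV[R]_M)
    (p j : 'I_M) : R :=
  Num.max `|nu_minus u p j| (nu_plus u p j).

(* The first two cases overlap when u p k 0 * u j k 0 = 0, where both give 0. *)
Definition a_coef (R : realType) (M : nat) (lam : 'I_M -> R)
    (u : 'I_M -> 'cV[R]_M) (k p j : 'I_M) : R :=
  if 0 <= lam p * lam j then
    if 0 <= u p k 0 * u j k 0 then nu_plus u p j * (u p k 0 * u j k 0)
    else nu_minus u p j * (u p k 0 * u j k 0)
  else nu_max u p j * `|u p k 0 * u j k 0|.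

Definition eps_c (R : realType) (M : nat) (lam : 'I_M -> R)
    (u : 'I_M -> 'cV[R]_M) (k : 'I_M) : R :=
  M%:R * \sum_(p < M) \sum_(j < M | (0 < j)%N)
    `|lam p * lam j| / (1 - `|lam p * lam j|) * a_coef lam u k p j.

(* Main.v *)
Require Import Defs.
From mathcomp Require Import all_boot all_order all_algebra.
From mathcomp Require Import reals.
From mathcomp Require Import ring lra.

(** Unrolling the recursion gives nhat(t) as the sum over tau of
    P^(t - tau + 1) xi(tau), and the orthonormal eigenvectors give
    P^s = \sum_p lam_p^s u_p u_p^T.  Both claims come from isolating the
    leading eigenvector, whose entries are all 1 / sqrt M, and bounding what is
    left by geometric series (damped_sum_le).

    For the first claim, the leading mode of nhat(t) is exactly n_cent(t).  The
    mode p > 0 is a sum of lam_p^(t - tau + 1) u_p^k (u_p . xi(tau)), where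
    `|u_p^k| <= 1 and `|u_p . xi(tau)| is at most the l1 norm of the unit vector
    u_p, hence at most sqrt M; summing over tau gives the p-th term of eps_n.

    For the second claim, the squared kernel is a double sum over modes (p, q)
    of (lam_p lam_q)^s (u_p^k u_q^k) (u_p^j u_q^j).  The terms with q leading
    add up to P^s k j / M, and so contribute nhat^k(t) / M.  For q > 0 one has
    `|lam_p lam_q| < 1; the sum over the selected agents j of u_p^j u_q^j lies
    between nu_minus and nu_plus, since selecting a set of agents can at best
    retain all the terms of one sign.  If lam_p lam_q >= 0 the sign of
    u_p^k u_q^k tells which end matters, and otherwise the powers alternate in
    sign and only the absolute value is controlled: these are the cases of
    a_coef, and the geometric series turns them into eps_c / M. *)

Set Implicit Arguments.
Unset Strict Implicit.
Unset Printing Implicit Defensive.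

Import Order.TTheory GRing.Theory Num.Theory.
Local Open Scope ring_scope.

(** * Damped sums *)

Lemma geometric_sum_le (R : realFieldType) (x : R) (t : nat) :
  0 <= x < 1 -> \sum_(1 <= tau < t.+1) x ^+ (t - tau + 1) <= x / (1 - x).
Proof.
move=> /andP[x0 x1]; have d0 : 0 < 1 - x by rewrite subr_gt0.
elim: t => [|t IHt]; first by rewrite big_geq// divr_ge0// ltW.
rewrite big_nat_recr//= subnn add0n expr1.
have -> : \sum_(1 <= tau < t.+1) x ^+ (t.+1 - tau + 1) =
          x * \sum_(1 <= tau < t.+1) x ^+ (t - tau + 1).
  rewrite mulr_sumr; apply: eq_big_nat => tau /andP[_ lt_tau].
  by rewrite subSn// addSn exprS.
(* x / (1 - x) is the fixed point of y |-> x * y + x *)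
have -> : x / (1 - x) = x * (x / (1 - x)) + x by field; rewrite gt_eqF.
by rewrite lerD2r ler_wpM2l.
Qed.

(** The hypothesis compares each term with that of the geometric series of
    ratio `|x|, which allows for both a one-sided bound on f when x >= 0 and a
    two-sided one when x < 0. *)
Lemma damped_sum_le (R : realFieldType) (x C : R) (f : nat -> R) (t : nat) :
    `|x| < 1 -> 0 <= C -> (forall s tau, x ^+ s * f tau <= `|x| ^+ s * C) ->
  \sum_(1 <= tau < t.+1) x ^+ (t - tau + 1) * f tau <= `|x| / (1 - `|x|) * C.
Proof.
move=> x1 C0 le_f.
apply: (@le_trans _ _ (\sum_(1 <= tau < t.+1) `|x| ^+ (t - tau + 1) * C)).
  by apply: ler_sum.
by rewrite -mulr_suml ler_wpM2r// geometric_sum_le// normr_ge0.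
Qed.

Lemma norm_damped_sum_le (R : realFieldType) (x C : R) (f : nat -> R)
    (t : nat) :
    `|x| < 1 -> (forall tau, `|f tau| <= C) ->
  `|\sum_(1 <= tau < t.+1) x ^+ (t - tau + 1) * f tau|
    <= `|x| / (1 - `|x|) * C.
Proof.
move=> x1 le_f; have C0 : 0 <= C := le_trans (normr_ge0 _) (le_f 0%N).
have le_term s y : `|y| <= C -> x ^+ s * y <= `|x| ^+ s * C.
  move=> le_y; apply: (le_trans (ler_norm _)).
  by rewrite normrM normrX ler_wpM2l// exprn_ge0.
rewrite ler_norml; apply/andP; split; last first.
  by apply: damped_sum_le => // s tau; apply: le_term.
rewrite lerNl -sumrN; under eq_bigr do rewrite -mulrN.
apply: damped_sum_le => // s tau.
by apply: le_term; rewrite normrN.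
Qed.

(** * Bounds on unit vectors and on partial sums *)

Lemma unit_vector_entry_le1 (R : realDomainType) (M : nat) (v : 'I_M -> R) k :
  \sum_d v d * v d = 1 -> `|v k| <= 1.
Proof.
move=> v1; rewrite -(@expr_le1 _ 2)// real_normK ?num_real//.
rewrite expr2 -v1 (bigD1 k)//= lerDl sumr_ge0// => d _.
by rewrite -expr2 sqr_ge0.
Qed.

(** Summing 2 s `|v d| <= s^2 (v d)^2 + 1 with s = sqrt M gives
    2 s `|v|_1 <= 2 s^2. *)
Lemma unit_vector_l1_le (R : rcfType) (M : nat) (v : 'I_M -> R) :
  \sum_d v d * v d = 1 -> \sum_d `|v d| <= Num.sqrt M%:R.
Proof.
move=> v1; set s := Num.sqrt M%:R; have s2 : s ^+ 2 = M%:R by rewrite sqr_sqrtr.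
have [M0|Mgt0] := posnP M.
  by subst M; rewrite big_ord0 sqrtr_ge0.
have s0 : 0 < s by rewrite sqrtr_gt0 ltr0n.
rewrite -(ler_pM2l s0) -(@ler_pM2l _ 2)// mulr_sumr mulr_sumr.
apply: (@le_trans _ _ (\sum_d (s ^+ 2 * (v d * v d) + 1))).
  apply: ler_sum => d _.
  rewrite -[v d * v d]expr2 -[v d ^+ 2]real_normK ?num_real//.
  have := sqr_ge0 (s * `|v d| - 1); nra.
rewrite big_split/= -mulr_sumr v1 sumr_const card_ord -s2; lra.
Qed.

(** Weights in [0, 1] at best keep all the terms of one sign and drop the
    others; x will be the indicator vector of the agents that chose an arm. *)
Lemma selected_sum_le (R : numDomainType) (M : nat) (w x : 'I_M -> R)
    (P : pred 'I_M) :
    (forall d, 0 <= x d <= 1) -> (forall d, P d -> 0 <= w d) ->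
    (forall d, ~~ P d -> w d <= 0) ->
  \sum_d w d * x d <= \sum_(d | P d) w d.
Proof.
move=> x01 wP wNP; rewrite [leRHS]big_mkcond; apply: ler_sum => d _.
have /andP[x0 x1] := x01 d; case: ifPn => [/wP w0|/wNP w0].
  by rewrite ler_piMr.
exact: mulr_le0_ge0.
Qed.

Lemma selected_sum_bounds (R : realDomainType) (M : nat) (w x : 'I_M -> R) :
    (forall d, 0 <= x d <= 1) ->
  \sum_(d | w d <= 0) w d <= \sum_d w d * x d <= \sum_(d | 0 <= w d) w d.
Proof.
move=> x01; apply/andP; split.
  rewrite -lerN2 -!sumrN; under eq_bigr do rewrite -mulNr.
  apply: selected_sum_le => // d; first by rewrite oppr_ge0.
  by rewrite -ltNge oppr_le0 => /ltW.
by apply: selected_sum_le => // d; rewrite -ltNge => /ltW.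
Qed.

(** * Spectral form of the consensus estimate *)

(** The s-th power of the consensus matrix, expanded in its eigenvectors. *)
Definition spectral_power (R : realType) (M : nat) (lam : 'I_M -> R)
    (u : 'I_M -> 'cV[R]_M) (s : nat) : 'M[R]_M :=
  \sum_p lam p ^+ s *: (u p *m (u p)^T).

Section Spectral.
Variables (R : realType) (M : nat) (A : 'M[R]_M).
Variables (lam : 'I_M -> R) (u : 'I_M -> 'cV[R]_M).
Hypothesis specA : consensus_spectrum A lam u.

Lemma spectral_powerE s k j :
  spectral_power lam u s k j = \sum_p lam p ^+ s * u p k 0 * u p j 0.
Proof.
rewrite summxE; apply: eq_bigr => p _.
by rewrite !mxE big_ord1 !mxE mulrA.
Qed.

(** Orthonormality says that the matrix U of eigenvectors has U^T U = 1;
    completeness, U U^T = 1, follows because U is square. *)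
Lemma spectral_power0 : spectral_power lam u 0 = 1%:M.
Proof.
pose U := \matrix_(d, p) u p d 0.
have : U^T *m U = 1%:M.
  apply/matrixP => p q; rewrite !mxE -(spectrum_orthonormal specA).
  by apply: eq_bigr => d _; rewrite !mxE.
move/mulmx1C => <-; apply/matrixP => k j; rewrite spectral_powerE mxE.
by apply: eq_bigr => p _; rewrite !mxE expr0 mul1r.
Qed.

Lemma spectral_powerS s :
  A *m spectral_power lam u s = spectral_power lam u s.+1.
Proof.
rewrite mulmx_sumr; apply: eq_bigr => p _.
by rewrite -scalemxAr mulmxA (spectrum_eigen specA) -scalemxAl scalerA exprSr.
Qed.

Lemma consensus_unrolled (n x : nat -> 'cV[R]_M) t :
    n 0%N = 0 -> (forall t, n t.+1 = A *m (n t + x t.+1)) ->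
  n t = \sum_(1 <= tau < t.+1) spectral_power lam u (t - tau + 1) *m x tau.
Proof.
move=> n0 nS; elim: t => [|t IHt]; first by rewrite n0 big_geq.
rewrite nS big_nat_recr//= subnn mulmxDr; congr (_ + _).
  rewrite IHt mulmx_sumr; apply: eq_big_nat => tau /andP[_ lt_tau].
  by rewrite mulmxA spectral_powerS subSn// addSn.
by rewrite -spectral_powerS spectral_power0 mulmx1.
Qed.

Lemma spectral_unit_vector p : \sum_d u p d 0 * u p d 0 = 1.
Proof. by rewrite (spectrum_orthonormal specA) eqxx. Qed.

Lemma norm_eigenvalue_lt1 (p : 'I_M) : (0 < p)%N -> `|lam p| < 1.
Proof.
by move=> p0; rewrite ltr_norml (spectrum_gtN1 specA) (spectrum_lt1 specA).
Qed.

Lemma norm_eigenvalue_le1 p : `|lam p| <= 1.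
Proof.
have [p0|/norm_eigenvalue_lt1/ltW//] := posnP p.
by rewrite (spectrum_lam1 specA)// normr1.
Qed.

Lemma norm_eigenvalue_mul_lt1 (p q : 'I_M) : (0 < q)%N -> `|lam p * lam q| < 1.
Proof.
move=> q0; rewrite normrM; apply: le_lt_trans (norm_eigenvalue_lt1 q0).
by rewrite ler_piMl// norm_eigenvalue_le1.
Qed.

Lemma leading_entry_mul (p d k : 'I_M) :
  p = 0%N :> nat -> u p d 0 * u p k 0 = M%:R^-1.
Proof.
move=> p0; rewrite (spectrum_u1 specA)// !mxE -invfM -expr2 sqr_sqrtr//.
Qed.

End Spectral.

Lemma split_leading (V : nmodType) (M : nat) (p0 : 'I_M) (F : 'I_M -> V) :
  p0 = 0%N :> nat -> \sum_p F p = F p0 + \sum_(p < M | (0 < p)%N) F p.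
Proof.
move=> p00; rewrite (bigD1 p0)//=; congr (_ + _); apply: eq_bigl => p.
by rewrite -val_eqE /= p00 lt0n.
Qed.

(** * The two error bounds *)

Section ErrorBounds.
Variables (R : realType) (M : nat) (A : 'M[R]_M).
Variables (lam : 'I_M -> R) (u : 'I_M -> 'cV[R]_M).
Hypothesis specA : consensus_spectrum A lam u.
Variables (x : nat -> 'cV[R]_M) (n : nat -> 'cV[R]_M).
Hypothesis x01 : forall tau j, 0 <= x tau j 0 <= 1.
Hypothesis n0 : n 0%N = 0.
Hypothesis nS : forall t, n t.+1 = A *m (n t + x t.+1).

Lemma consensus_modes t k :
  n t k 0 = \sum_p \sum_(1 <= tau < t.+1)
    lam p ^+ (t - tau + 1) * (u p k 0 * \sum_j u p j 0 * x tau j 0).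
Proof.
rewrite (consensus_unrolled specA t n0 nS) summxE exchange_big/=.
apply: eq_bigr => tau _; rewrite mxE.
under [LHS]eq_bigr do rewrite spectral_powerE mulr_suml.
rewrite exchange_big/=; apply: eq_bigr => p _.
rewrite !mulr_sumr; apply: eq_bigr => j _; ring.
Qed.

(** The leading mode is exactly the network average of the selections, so the
    error is the sum of the other modes, all of which decay. *)
Lemma consensus_error t k :
  `|n t k 0 - M%:R^-1 * \sum_(1 <= tau < t.+1) \sum_j x tau j 0| <= eps_n lam.
Proof.
pose p0 : 'I_M := Ordinal (leq_ltn_trans (leq0n k) (ltn_ord k)).
rewrite consensus_modes (split_leading (p0 := p0))//.
have -> : \sum_(1 <= tau < t.+1)
      lam p0 ^+ (t - tau + 1) * (u p0 k 0 * \sum_j u p0 j 0 * x tau j 0) =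
    M%:R^-1 * \sum_(1 <= tau < t.+1) \sum_j x tau j 0.
  rewrite mulr_sumr; apply: eq_bigr => tau _.
  rewrite (spectrum_lam1 specA)// expr1n mul1r !mulr_sumr.
  by apply: eq_bigr => j _; rewrite mulrA (leading_entry_mul specA).
rewrite addrAC subrr add0r /eps_n mulr_sumr.
apply: (le_trans (ler_norm_sum _ _ _)).
apply: ler_sum => p p_gt0; rewrite [leRHS]mulrC.
apply: norm_damped_sum_le => [|tau]; first exact: (norm_eigenvalue_lt1 specA).
have up1 := spectral_unit_vector specA p.
rewrite normrM; apply: (@le_trans _ _ `|\sum_j u p j 0 * x tau j 0|).
  rewrite ler_piMl//.
  exact: (@unit_vector_entry_le1 _ _ (fun d => u p d 0)).
apply: le_trans (unit_vector_l1_le up1).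
apply: (le_trans (ler_norm_sum _ _ _)); apply: ler_sum => j _.
by have /andP[? ?] := x01 tau j; rewrite normrM ler_piMr// ger0_norm.
Qed.

(** When lam p * lam q >= 0, only an upper bound on the factor after the power
    is needed, and the sign of u p k 0 * u q k 0 decides whether it comes from
    nu_plus or from nu_minus.  When lam p * lam q < 0 the powers alternate in
    sign, so that the factor has to be bounded in absolute value. *)
Lemma mode_pair_le t (k p q : 'I_M) : (0 < q)%N ->
  \sum_(1 <= tau < t.+1) (lam p * lam q) ^+ (t - tau + 1) *
      (u p k 0 * u q k 0 * \sum_j u p j 0 * u q j 0 * x tau j 0)
  <= `|lam p * lam q| / (1 - `|lam p * lam q|) * a_coef lam u k p q.
Proof.
move=> q_gt0; have l1 := norm_eigenvalue_mul_lt1 specA p q_gt0.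
have bounds tau : nu_minus u p q <= \sum_j u p j 0 * u q j 0 * x tau j 0
                    <= nu_plus u p q.
  exact: (@selected_sum_bounds _ _ (fun j => u p j 0 * u q j 0)).
have plus0 : 0 <= nu_plus u p q by apply: sumr_ge0.
have minus0 : nu_minus u p q <= 0 by apply: sumr_le0.
rewrite /a_coef; case: ifPn => [l0|_].
  case: ifPn => [w0|]; last rewrite -ltNge => /ltW w0.
    apply: damped_sum_le => // [|s tau]; first exact: mulr_ge0.
    rewrite ger0_norm// ler_wpM2l ?exprn_ge0// mulrC ler_wpM2r//.
    by have /andP[] := bounds tau.
  apply: damped_sum_le => // [|s tau]; first exact: mulr_le0 minus0 w0.
  rewrite ger0_norm// ler_wpM2l ?exprn_ge0// mulrC ler_wnM2r//.
  by have /andP[] := bounds tau.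
apply: le_trans (ler_norm _) _; apply: norm_damped_sum_le => // tau.
rewrite normrM mulrC ler_wpM2r// /nu_max ler_norml le_max.
have /andP[lo hi] := bounds tau; rewrite hi orbT andbT.
by apply: le_trans lo; rewrite lerNl le_max ler0_norm// lexx.
Qed.

(** The square expands over pairs of modes (p, q).  The pairs with q leading
    rebuild the estimate itself, because lam q = 1 and
    u q k 0 * u q j 0 = 1 / M turn them back into its modes, divided by M. *)
Lemma squared_kernel_le t k :
  \sum_(1 <= tau < t.+1) \sum_j
    (\sum_p lam p ^+ (t - tau + 1) * u p k 0 * u p j 0) ^+ 2 * x tau j 0
  <= (n t k 0 + eps_c lam u k) / M%:R.
Proof.
pose p0 : 'I_M := Ordinal (leq_ltn_trans (leq0n k) (ltn_ord k)).
have M0 : M%:R != 0 :> R by rewrite pnatr_eq0 -lt0n (leq_trans _ (ltn_ord k)).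
pose F p q := \sum_(1 <= tau < t.+1) (lam p * lam q) ^+ (t - tau + 1) *
      (u p k 0 * u q k 0 * \sum_j u p j 0 * u q j 0 * x tau j 0).
have -> : \sum_(1 <= tau < t.+1) \sum_j
    (\sum_p lam p ^+ (t - tau + 1) * u p k 0 * u p j 0) ^+ 2 * x tau j 0 =
    \sum_p \sum_q F p q.
  under [RHS]eq_bigr do rewrite exchange_big/=.
  rewrite [RHS]exchange_big/=; apply: eq_bigr => tau _.
  under eq_bigr do rewrite expr2 big_distrlr/= mulr_suml.
  rewrite exchange_big/=; apply: eq_bigr => p _.
  under eq_bigr do rewrite mulr_suml.
  rewrite exchange_big/=; apply: eq_bigr => q _.
  rewrite !mulr_sumr; apply: eq_bigr => j _; rewrite exprMn; ring.
under eq_bigr do rewrite (split_leading (p0 := p0))//.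
rewrite big_split/= mulrDl lerD//.
  rewrite consensus_modes mulr_suml le_eqVlt; apply/orP; left; apply/eqP.
  apply: eq_bigr => p _; rewrite mulr_suml; apply: eq_bigr => tau _.
  rewrite (spectrum_lam1 specA (p := p0))// mulr1 -!mulrA; congr (_ * (_ * _)).
  rewrite mulr_suml mulr_sumr; apply: eq_bigr => j _.
  rewrite -(leading_entry_mul specA (p := p0) k j)//; ring.
rewrite /eps_c mulrC mulKf//; apply: ler_sum => p _; apply: ler_sum => q.
exact: mode_pair_le.
Qed.

End ErrorBounds.

Theorem proposition1 (R : realType) (M N : nat)
    (e : rel 'I_M) (he : connected_simple_graph e)
    (kappa : R) (hkappa : 0 < kappa <= 1)
    (hP : doubly_stochastic (consensus_mx e kappa))
    (lam : 'I_M -> R) (u : 'I_M -> 'cV[R]_M)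
    (hspec : consensus_spectrum (consensus_mx e kappa) lam u)
    (arm : 'I_M -> nat -> 'I_N) (r : 'I_N -> 'I_M -> nat -> R)
    (nhat shat muhat : 'I_N -> nat -> 'cV[R]_M)
    (hrun : running_consensus (consensus_mx e kappa) arm r nhat shat muhat)
    (i : 'I_N) (k : 'I_M) (t : nat) (ht : (1 <= t)%N) :
  (n_cent R arm i t - eps_n lam <= nhat i t k 0 /\
   nhat i t k 0 <= n_cent R arm i t + eps_n lam) /\
  \sum_(1 <= tau < t.+1) \sum_(j < M)
    (\sum_(p < M) lam p ^+ (t - tau + 1) * u p k 0 * u p j 0) ^+ 2
      * xi R arm i tau j 0
  <= (nhat i t k 0 + eps_c lam u k) / M%:R.
Proof.
have xi01 tau j : 0 <= xi R arm i tau j 0 <= 1.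
  by rewrite mxE ler0n lern1 leq_b1.
have n0 := consensus_n0 hrun i; have nS := consensus_nS hrun i.
split; last exact: (squared_kernel_le hspec xi01 n0 nS).
have := consensus_error hspec xi01 n0 nS t k.
by rewrite ler_distl => /andP[].
Qed.
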